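(* Let $g\colon\mathbb{R}\to\left]-\infty,+\infty\right]$ be such that for every $x\in\mathbb{R}$, $g^*(-x)=g(x)\ge 0$, and set $q\colon\mathbb{R}\to\mathbb{R}\colon x\mapsto\tfrac12|x|^2$. Then $$F\colon\mathbb{R}^2\to\left]-\infty,+\infty\right]\colon (x,y)\mapsto q\Big(\frac{x+y}{\sqrt2}\Big)+g\Big(\frac{x-y}{\sqrt2}\Big)$$ is an autoconjugate representer for $\operatorname{Id}\colon\mathbb{R}\to\mathbb{R}\colon x\mapsto x$.
   Context: The Fenchel conjugate of $g\colon\mathbb{R}\to\left]-\infty,+\infty\right]$ is $g^*(u)=\sup_{y\in\mathbb{R}}uy-g(y)$. For $F\colon\mathbb{R}^2\to\left]-\infty,+\infty\right]$, $F^*(y,x)=\sup_{(u,v)\in\mathbb{R}^2}uy+vx-F(u,v)$. $F$ is autoconjugate if $F^*(y,x)=F(x,y)$ for all $(x,y)\in\mathbb{R}^2$. $F$ is a representer for $\operatorname{Id}$ if, for all $(x,y)\in\mathbb{R}^2$, $F(x,y)=xy$ if and only if $y=x$. An autoconjugate representer for $\operatorname{Id}$ is a function that is both autoconjugate and a representer for $\operatorname{Id}$. *)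

(* Defs.v *)
(* A function with values in ]-oo, +oo] is a function
   f : T -> \bar R together with the condition [gtNy f]. *)
From mathcomp Require Import all_boot all_order all_algebra.
From mathcomp Require Import boolp classical_sets reals ereal.
Set Implicit Arguments.
Unset Strict Implicit.
Unset Printing Implicit Defensive.
Import Order.TTheory GRing.Theory Num.Theory.
Local Open Scope classical_set_scope.
Local Open Scope ring_scope.

Definition gtNy (R : realType) (T : Type) (f : T -> \bar R) : Prop :=
  forall x, (-oo < f x)%E.

Definition fenchel_conj (R : realType) (g : R -> \bar R) (u : R) : \bar R :=
  ereal_sup (range (fun y : R => ((u * y)%:E - g y)%E : \bar R)).

(* The first argument of the conjugate is dual to the first variable of F. *)
Definition fenchel_conj2 (R : realType) (F : R * R -> \bar R) (p : R * R) :
    \bar R :=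
  ereal_sup (range (fun w : R * R =>
    ((w.1 * p.1 + w.2 * p.2)%:E - F w)%E : \bar R)).

Definition autoconjugate (R : realType) (F : R * R -> \bar R) : Prop :=
  forall x y : R, fenchel_conj2 F (y, x) = F (x, y).

Definition representer (R : realType) (A : R -> R) (F : R * R -> \bar R) :
    Prop :=
  forall x y : R, F (x, y) = (x * y)%:E <-> y = A x.

Definition autoconjugate_representer (R : realType) (A : R -> R)
    (F : R * R -> \bar R) : Prop :=
  autoconjugate F /\ representer A F.

(* Main.v *)
Require Import Defs.
From mathcomp Require Import all_boot all_order all_algebra.
From mathcomp Require Import boolp classical_sets reals ereal.
From mathcomp Require Import ring lra.
Set Implicit Arguments.
Unset Strict Implicit.
Unset Printing Implicit Defensive.
Import Order.TTheory GRing.Theory Num.Theory.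
Local Open Scope classical_set_scope.
Local Open Scope ring_scope.

(** In the coordinates [s = (x + y) / sqrt 2] and [d = (x - y) / sqrt 2], which
    are obtained from [(x, y)] by an orthogonal map, [F] is the separable
    function [q s + g d]. The conjugate is taken at the swapped point [(y, x)],
    and the swap fixes [s] and changes the sign of [d]. The conjugate of a
    separable function is separable, so the value there is
    [q^* s + g^* (- d)]: the half square is its own conjugate, and
    [g^* (- d) = g d] by hypothesis. The splitting is
    [fenchel_conj2_rotation]; the sign change comes from
    [swap_pairing_rotation].

    For the representer property, [x * y = q s - q d], so that
    [F (x, y) = x * y] amounts to [g d = - q d]. As [g] is nonnegative, this
    forces [d = 0], that is [y = x]; conversely it holds at [d = 0] because
    [g 0 = g^* 0 = - inf g <= 0]. *)

Lemma invsqrt2_sqr (R : realType) : (Num.sqrt 2)^-1 * (Num.sqrt 2)^-1 = 2^-1 :> R.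
Proof. by rewrite -invfM -expr2 sqr_sqrtr. Qed.

(** Exchanging [x] and [y] is the reflection that negates the second rotated
    coordinate; hence the minus sign. *)
Lemma swap_pairing_rotation (R : realType) (u v x y : R) :
  u * y + v * x =
  (u + v) / Num.sqrt 2 * ((x + y) / Num.sqrt 2)
  - (u - v) / Num.sqrt 2 * ((x - y) / Num.sqrt 2).
Proof.
rewrite [X in X - _]mulrACA [X in _ - X]mulrACA invsqrt2_sqr.
by field.
Qed.

Lemma mul_rotation (R : realType) (x y : R) :
  x * y = 2^-1 * `|(x + y) / Num.sqrt 2| ^+ 2
          - 2^-1 * `|(x - y) / Num.sqrt 2| ^+ 2.
Proof.
rewrite !real_normK ?num_real// !exprMn [_^-1 ^+ 2]expr2 invsqrt2_sqr.
by field.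
Qed.

Lemma rotation_sum (R : realType) (a b : R) :
  ((a + b) / Num.sqrt 2 + (a - b) / Num.sqrt 2) / Num.sqrt 2 = a.
Proof. by rewrite -mulrDl -mulrA invsqrt2_sqr; field. Qed.

Lemma rotation_diff (R : realType) (a b : R) :
  ((a + b) / Num.sqrt 2 - (a - b) / Num.sqrt 2) / Num.sqrt 2 = b.
Proof. by rewrite -mulrBl -mulrA invsqrt2_sqr; field. Qed.

(** The Fenchel-Young inequality. *)
Lemma fenchel_conj_ge (R : realType) (g : R -> \bar R) (u y : R) :
  ((u * y)%:E - g y <= fenchel_conj g u)%E.
Proof. by apply: ereal_sup_ubound; exists y. Qed.

(** Only the vanishing linear term is left at [u = 0], so the conjugate there
    is [- inf g]. *)
Lemma fenchel_conj0_le0 (R : realType) (g : R -> \bar R) :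
  (forall x, 0 <= g x)%E -> (fenchel_conj g 0 <= 0)%E.
Proof.
move=> g0; apply: ge_ereal_sup => _ [y _ <-].
by rewrite mul0r add0e oppe_le0.
Qed.

(** This is [(a - s) ^+ 2 >= 0]: the upper bound half of the half square being
    its own conjugate. *)
Lemma half_square_young (R : realType) (a s : R) :
  a * s - 2^-1 * `|a| ^+ 2 <= 2^-1 * `|s| ^+ 2.
Proof.
rewrite !real_normK ?num_real//.
have := sqr_ge0 (a - s); nra.
Qed.

(** In the rotated coordinates [(a, b)] of the point [(u, v)], the supremum
    splits into one over [a], attained at [a = s], and the one over [b] that
    defines the conjugate of [g] at [- d]. *)
Lemma fenchel_conj2_rotation (R : realType) (g : R -> \bar R) (x y : R) :
  gtNy g ->
  fenchel_conj2 (fun p : R * R =>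
    ((2^-1 * `|(p.1 + p.2) / Num.sqrt 2| ^+ 2)%:E
     + g ((p.1 - p.2) / Num.sqrt 2)%R)%E) (y, x) =
  ((2^-1 * `|(x + y) / Num.sqrt 2| ^+ 2)%:E
   + fenchel_conj g (- ((x - y) / Num.sqrt 2)))%E.
Proof.
move=> gNy; apply/eqP; rewrite eq_le; apply/andP; split.
- apply: ge_ereal_sup => _ [[u v] _ <-] /=.
  rewrite swap_pairing_rotation.
  set a := (u + v) / _; set b := (u - v) / _.
  set s := (x + y) / _; set d := (x - y) / _.
  have := fenchel_conj_ge g (- d) b; have := gNy b.
  case: (g b) => [r _|_ _|//] /=; last by rewrite addeC/= leNye.
  move=> young_g.
  have := leeD (half_square_young a s : (_%:E <= _%:E)%E) young_g.
  by apply: le_trans; rewrite lee_fin; lra.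
- rewrite addeC -leeBrDr//; apply: ge_ereal_sup => _ [b _ <-].
  rewrite leeBrDr//.
  set s := (x + y) / _; set d := (x - y) / _.
  (* the point whose rotated coordinates are [(s, b)] *)
  apply: ereal_sup_ubound.
  exists ((s + b) / Num.sqrt 2, (s - b) / Num.sqrt 2) => //=.
  rewrite swap_pairing_rotation rotation_sum rotation_diff -/s -/d.
  have := gNy b; case: (g b) => [r _|_|//] //=.
  congr (_%:E).
  by rewrite real_normK ?num_real//; field.
Qed.

Theorem theorem4p2 (R : realType) (g : R -> \bar R) (hgNy : gtNy g)
    (hg : forall x : R, fenchel_conj g (- x) = g x /\ (0 <= g x)%E) :
  let q : R -> R := fun x => 2^-1 * `|x| ^+ 2 in
  let F : R * R -> \bar R := fun p =>
    ((q ((p.1 + p.2) / Num.sqrt 2)%R)%:E + g ((p.1 - p.2) / Num.sqrt 2)%R)%E in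
  gtNy F /\ autoconjugate_representer (fun x : R => x) F.
Proof.
move=> q F.
have g_ge0 x : (0 <= g x)%E by have [] := hg x.
have g0 : g 0 = 0%E.
  apply/eqP; rewrite eq_le g_ge0 andbT.
  by have [<- _] := hg 0; rewrite oppr0 fenchel_conj0_le0.
split; [|split].
- move=> p; rewrite /F; have := hgNy ((p.1 - p.2) / Num.sqrt 2).
  by case: (g _) => // r _; rewrite ltNyr.
- move=> x y; apply: (etrans (fenchel_conj2_rotation x y hgNy)).
  by rewrite (hg _).1.
- move=> x y; rewrite /F /= (mul_rotation x y) -!/(q _); split; last first.
    by move=> ->; rewrite subrr mul0r g0 /q normr0 expr0n/= mulr0 subr0 adde0.
  set d := (x - y) / _.
  have := g_ge0 d; case: (g d) => [r|//|//]; rewrite lee_fin => r0.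
  move=> [/addrI rE].
  have : d == 0.
    rewrite -normr_eq0 -sqrf_eq0 eq_le sqr_ge0 andbT.
    by move: r0; rewrite rE /q; lra.
  by rewrite mulf_eq0 invr_eq0 sqrtr_eq0 leNgt ltr0n orbF subr_eq0 => /eqP.
Qed.
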